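(* Let $a=\sqrt{2\left(1-\sqrt{0.5}\right)}$, $b=\sqrt{2\left(1+\sqrt{0.5}\right)}$ and $\delta=\sqrt{b/a}$. For $\gamma\ge 0$ let $$\mathcal{H}_2(\gamma)=Q_1\left(a\sqrt{\gamma},b\sqrt{\gamma}\right)-\frac12 I_0\left(\sqrt2\,\gamma\right)e^{-2\gamma}$$ be the bit error probability of DQPSK modulation with Gray coding. Then for every $\gamma\ge 0$, $$\mathcal{H}_2(\gamma)\ \le\ \mathcal{U}(\gamma):=\frac1\delta\,\mathcal{K}(a,b,\gamma)+\frac12 I_0\left(\sqrt2\,\gamma\right)e^{-2\gamma},$$ where $\mathcal{K}(a,b,\gamma)=Q\left((b-a)\sqrt{\gamma}\right)-Q\left((b+a)\sqrt{\gamma}\right)$.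
   Context: $\gamma$ is the signal-to-noise ratio per bit. $I_v$ denotes the modified Bessel function of the first kind of order $v$. $Q(x)=\frac{1}{\sqrt{2\pi}}\int_x^\infty e^{-t^2/2}\,dt$ is the Gaussian $Q$-function. $Q_1$ is the first-order Marcum $Q$-function, $Q_1(\alpha,\beta)=\int_\beta^\infty t\exp\left(-\frac{t^2+\alpha^2}{2}\right)I_0(\alpha t)\,dt$. *)

(* Defs.v *)
From Stdlib Require Import Reals Factorial.
From Coquelicot Require Import Coquelicot.
Open Scope R_scope.

(* Integer orders only, so that Gamma (v + k + 1) is (v + k)!. *)
Definition bessel_I (v : nat) (x : R) : R :=
  Series (fun k : nat =>
    (x / 2) ^ (2 * k + v) / (INR (fact k) * INR (fact (k + v)))).

(* Improper Riemann integral over [x, +oo); RInt_gen is total, and meaningful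
   when the integral converges, as it does for the integrands below. *)
Definition int_from (f : R -> R) (x : R) : R :=
  RInt_gen f (at_point x) (Rbar_locally p_infty).

Definition gaussQ (x : R) : R :=
  1 / sqrt (2 * PI) * int_from (fun t => exp (- (t ^ 2 / 2))) x.

Definition marcumQ1 (alpha beta : R) : R :=
  int_from (fun t =>
    t * exp (- ((t ^ 2 + alpha ^ 2) / 2)) * bessel_I 0 (alpha * t)) beta.

Definition kernK (a b gamma : R) : R :=
  gaussQ ((b - a) * sqrt gamma) - gaussQ ((b + a) * sqrt gamma).

(* Main.v *)
(** Integrating [Q_1(a, b)] by parts gives
    [exp (-(a^2+b^2)/2) I_0(ab)] plus the integral over [t >= b] of
    [a I_1(at) exp (-(t^2+a^2)/2)], while [Q(b-a) - Q(b+a)] is [1 / sqrt (2 PI)] times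
    the integral of [2 sinh(at) exp (-(t^2+a^2)/2)].  The integrands compare pointwise
    because [sqrt x * I_1(x) <= sqrt (2/PI) * sinh x], i.e. [I_1 <= I_(1/2)].
    For the latter, [I_1(x)] is the sum of [w_(k+1) x^(2k+1)/(2k+1)!] with the Wallis
    ratios [w_n = C(2n,n)/4^n], which satisfy [n w_n^2 <= 1/PI]; by AM-GM in each term
    (a Cauchy-Schwarz argument),
    [I_1(x)^2 <= 2/(PI x) * sinh x * (cosh x - 1)], and [cosh x - 1 <= sinh x]. *)

Require Import Defs.
From Stdlib Require Import Reals.
From Coquelicot Require Import Coquelicot.
From Stdlib Require Import Lra Lia Factorial Classical.
Open Scope R_scope.

(** * Wallis ratios and sine integrals *)

Definition wallis (n : nat) : R := INR (fact (2 * n)) / (2 ^ n * INR (fact n)) ^ 2.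

(** The Wallis integrals: even indices carry the ratio [wallis], odd ones its reciprocal, and
    comparing neighbours yields [wallis_bound]. *)
Definition sin_moment (n : nat) : R := RInt (fun t => sin t ^ n) 0 (PI / 2).

Lemma wallis_succ (n : nat) :
  wallis (S n) = (2 * INR n + 1) / (2 * INR n + 2) * wallis n.
Proof.
  unfold wallis.
  replace (2 * S n)%nat with (S (S (2 * n))) by lia.
  rewrite !fact_simpl, !mult_INR, !S_INR, mult_INR; change (INR 2) with 2; change (2 ^ S n) with (2 * 2 ^ n).
  assert (INR (fact n) <> 0) by apply INR_fact_neq_0.
  assert (2 ^ n <> 0) by (apply pow_nonzero; lra).
  assert (0 <= INR n) by apply pos_INR.
  field; repeat split; lra.
Qed.

Lemma wallis_pos (n : nat) : 0 < wallis n.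
Proof.
  unfold wallis.
  assert (forall k, 0 < INR (fact k)) by (intro; apply INR_fact_lt_0).
  apply Rdiv_lt_0_compat; [auto|].
  apply pow_lt, Rmult_lt_0_compat; [apply pow_lt; lra | auto].
Qed.

Lemma continuous_sin_pow (n : nat) (t : R) : continuous (fun t => sin t ^ n) t.
Proof. apply (ex_derive_continuous (V := R_NormedModule)); auto_derive; trivial. Qed.

Lemma ex_RInt_sin_pow (n : nat) (a b : R) : ex_RInt (fun t => sin t ^ n) a b.
Proof.
  apply (ex_RInt_continuous (V := R_CompleteNormedModule)).
  intros; apply continuous_sin_pow.
Qed.

Lemma sin_moment_0 : sin_moment 0 = PI / 2.
Proof.
  unfold sin_moment; simpl; rewrite (RInt_const (V := R_CompleteNormedModule)).
  unfold scal; simpl; unfold mult; simpl; ring.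
Qed.

Lemma sin_moment_1 : sin_moment 1 = 1.
Proof.
  unfold sin_moment; apply is_RInt_unique.
  replace 1 with (minus (- cos (PI / 2)) (- cos 0))
    by (rewrite cos_PI2, cos_0; unfold minus, plus, opp; simpl; ring).
  apply (is_RInt_derive (V := R_CompleteNormedModule) (fun t => - cos t)).
  - intros; auto_derive; trivial; ring.
  - intros; apply continuous_sin_pow.
Qed.

(** The combined integrand is the derivative of [- cos t * sin t ^ S n], which vanishes at both
    endpoints. *)
Lemma sin_moment_succ_succ (n : nat) :
  (INR n + 2) * sin_moment (S (S n)) = (INR n + 1) * sin_moment n.
Proof.
  assert (H : is_RInt (fun t => (INR n + 2) * sin t ^ S (S n) - (INR n + 1) * sin t ^ n)
                0 (PI / 2) 0).
  { replace 0 with (minus (- cos (PI / 2) * sin (PI / 2) ^ S n) (- cos 0 * sin 0 ^ S n)) at 2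
      by (rewrite cos_PI2, sin_0; unfold minus, plus, opp; simpl; ring).
    apply (is_RInt_derive (V := R_CompleteNormedModule) (fun t => - cos t * sin t ^ S n)).
    - intros t _; auto_derive; trivial.
      assert (E := sin2_cos2 t); unfold Rsqr in E.
      assert (E' : cos t * cos t = 1 - sin t * sin t) by lra.
      change (match n with 0%nat => 1 | S _ => INR n + 1 end) with (INR (S n)).
      rewrite S_INR, <- !tech_pow_Rmult.
      transitivity (sin t * (sin t * sin t ^ n)
                    - (INR n + 1) * sin t ^ n * (cos t * cos t)); [ring | rewrite E'; ring].
    - intros t _; apply (ex_derive_continuous (V := R_NormedModule)); auto_derive; trivial. }
  apply (is_RInt_unique (V := R_CompleteNormedModule)) in H.
  assert (E : RInt (fun t => (INR n + 2) * sin t ^ S (S n) - (INR n + 1) * sin t ^ n)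
                0 (PI / 2)
          = (INR n + 2) * sin_moment (S (S n)) - (INR n + 1) * sin_moment n).
  { unfold sin_moment; apply is_RInt_unique.
    apply (is_RInt_minus (V := R_NormedModule));
      apply (is_RInt_scal (V := R_NormedModule)),
        (RInt_correct (V := R_CompleteNormedModule)), ex_RInt_sin_pow. }
  lra.
Qed.

(** Induction through the reduction formula, applied at [2 * n] and [2 * n + 1]. The odd case is a
    product equal to 1, ready to be substituted for 1 in [wallis_bound]. *)
Lemma sin_moment_wallis (n : nat) :
  sin_moment (2 * n) = PI / 2 * wallis n /\
  (2 * INR n + 1) * wallis n * sin_moment (2 * n + 1) = 1.
Proof.
  induction n as [|n [IH1 IH2]].
  - simpl (2 * 0)%nat; simpl (0 + 1)%nat; rewrite sin_moment_0, sin_moment_1.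
    unfold wallis; simpl; split; field.
  - assert (0 <= INR n) by apply pos_INR.
    assert (H1 := sin_moment_succ_succ (2 * n)).
    assert (H2 := sin_moment_succ_succ (2 * n + 1)).
    replace (2 * S n)%nat with (S (S (2 * n))) by lia.
    replace (S (S (2 * n)) + 1)%nat with (S (S (2 * n + 1))) by lia.
    rewrite mult_INR in H1; rewrite plus_INR, mult_INR in H2.
    change (INR 2) with 2 in *; change (INR 1) with 1 in *.
    rewrite wallis_succ, S_INR.
    set (u := sin_moment (S (S (2 * n)))) in *.
    set (v := sin_moment (S (S (2 * n + 1)))) in *.
    split.
    + apply (Rmult_eq_reg_l (2 * INR n + 2)); [|lra].
      rewrite H1, IH1; field; lra.
    + replace v with ((2 * INR n + 2) / (2 * INR n + 3) * sin_moment (2 * n + 1)).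
      * transitivity ((2 * INR n + 1) * wallis n * sin_moment (2 * n + 1));
          [field; lra | exact IH2].
      * apply (Rmult_eq_reg_l (2 * INR n + 3)); [|lra].
        transitivity ((2 * INR n + 1 + 1) * sin_moment (2 * n + 1)); [field; lra|].
        rewrite <- H2; ring.
Qed.

Lemma sin_moment_decreasing (n : nat) : sin_moment (S n) <= sin_moment n.
Proof.
  assert (P := PI_RGT_0).
  apply RInt_le; [lra | apply ex_RInt_sin_pow | apply ex_RInt_sin_pow |].
  intros t Ht; rewrite <- tech_pow_Rmult.
  assert (0 <= sin t) by (apply sin_ge_0; lra).
  assert (0 <= sin t ^ n) by (apply pow_le; assumption).
  assert (S := SIN_bound t); nra.
Qed.

(** The moment of index 2n+2 is at most that of index 2n+1. Multiplied by
    [(2 * INR n + 2) * wallis (S n)], the former becomes the left-hand side and the latter becomes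
    1. *)
Lemma wallis_bound (n : nat) : wallis (S n) ^ 2 * (PI * (INR n + 1)) <= 1.
Proof.
  assert (0 <= INR n) by apply pos_INR.
  destruct (sin_moment_wallis (S n)) as [H1 _].
  destruct (sin_moment_wallis n) as [_ H2].
  assert (D := sin_moment_decreasing (2 * n + 1)).
  replace (S (2 * n + 1)) with (2 * S n)%nat in D by lia.
  assert (W := wallis_pos n); assert (W' := wallis_pos (S n)).
  assert (E := wallis_succ n).
  assert (E' : (2 * INR n + 2) * wallis (S n) * sin_moment (2 * n + 1) = 1)
    by (transitivity ((2 * INR n + 1) * wallis n * sin_moment (2 * n + 1));
        [rewrite E; field; lra | exact H2]).
  rewrite H1 in D.
  apply Rle_trans with ((2 * INR n + 2) * wallis (S n) * (PI / 2 * wallis (S n))).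
  - right; field.
  - rewrite <- E'; apply Rmult_le_compat_l; [nra | exact D].
Qed.

(** * Entire power series; the series of sinh and cosh *)

Lemma CV_radius_infinite_of_ratio (a : nat -> R) :
  (forall n, 0 < a n) -> (forall n, INR (S n) * a (S n) <= a n) -> CV_radius a = p_infty.
Proof.
  intros Ha Hr; apply CV_radius_infinite_DAlembert.
  - intro n; apply Rgt_not_eq, Ha.
  - apply is_lim_seq_le_le with (fun _ => 0) (fun n => / INR (S n)).
    + intro n.
      assert (0 < INR (S n)) by (apply lt_0_INR; lia).
      assert (A := Ha n); assert (A' := Ha (S n)).
      rewrite Rabs_pos_eq by (left; apply Rdiv_lt_0_compat; assumption).
      split; [left; apply Rdiv_lt_0_compat; assumption|].
      apply (Rmult_le_reg_l (INR (S n) * a n)); [apply Rmult_lt_0_compat; assumption|].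
      apply Rle_trans with (INR (S n) * a (S n)); [right; field; lra|].
      apply Rle_trans with (a n); [apply Hr | right; field; lra].
    + apply is_lim_seq_const.
    + apply is_lim_seq_incr_1 with (u := fun n => / INR n).
      apply (is_lim_seq_inv INR p_infty); [apply is_lim_seq_INR | discriminate].
Qed.

Lemma is_pseries_of_CV_radius_infinite (a : nat -> R) (x : R) :
  CV_radius a = p_infty -> is_pseries a x (PSeries a x).
Proof.
  intro H; apply PSeries_correct, CV_radius_inside; rewrite H; exact I.
Qed.

(** The exponential series is split by parity at [x] and at [- x]; half the difference and half the
    sum of the two give the claims. *)
Lemma is_series_sinh_cosh (x : R) :
  is_series (fun k => x ^ (2 * k + 1) / INR (fact (2 * k + 1))) (sinh x) /\
  is_series (fun k => x ^ (2 * k) / INR (fact (2 * k))) (cosh x).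
Proof.
  set (a := fun n => / INR (fact n)).
  assert (Ha : forall n, 0 < a n) by (intro; apply Rinv_0_lt_compat, INR_fact_lt_0).
  (* One estimate for both parities: it is used with [2 * k] and [2 * k + 1] in the role of [n]. *)
  assert (Hr : forall n k, (k <= n)%nat -> INR (S k) * a (S (S n)) <= a n).
  { intros n k Hk; unfold a.
    assert (F := INR_fact_lt_0 n).
    assert (P := pos_INR n); assert (P' := pos_INR k).
    apply le_INR in Hk.
    rewrite !fact_simpl, !mult_INR, !S_INR.
    apply (Rmult_le_reg_l ((INR n + 1 + 1) * ((INR n + 1) * INR (fact n))));
      [repeat apply Rmult_lt_0_compat; lra|].
    apply Rle_trans with (INR k + 1); [right; field; lra|].
    apply Rle_trans with ((INR n + 1 + 1) * (INR n + 1)); [nra | right; field; lra]. }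
  assert (E : CV_radius (fun k => a (2 * k)%nat) = p_infty).
  { apply CV_radius_infinite_of_ratio; intro n; [apply Ha|].
    replace (2 * S n)%nat with (S (S (2 * n))) by lia; apply Hr; lia. }
  assert (O : CV_radius (fun k => a (2 * k + 1)%nat) = p_infty).
  { apply CV_radius_infinite_of_ratio; intro n; [apply Ha|].
    replace (2 * S n + 1)%nat with (S (S (2 * n + 1))) by lia; apply Hr; lia. }
  assert (HE := is_pseries_of_CV_radius_infinite _ (x ^ 2) E).
  assert (HO := is_pseries_of_CV_radius_infinite _ (x ^ 2) O).
  assert (X1 : exp x = PSeries (fun k => a (2 * k)%nat) (x ^ 2)
                       + x * PSeries (fun k => a (2 * k + 1)%nat) (x ^ 2)).
  { rewrite <- (is_pseries_unique _ _ _ (is_exp_Reals x)).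
    apply is_pseries_unique, is_pseries_odd_even; assumption. }
  assert (X2 : exp (- x) = PSeries (fun k => a (2 * k)%nat) (x ^ 2)
                       - x * PSeries (fun k => a (2 * k + 1)%nat) (x ^ 2)).
  { rewrite <- (is_pseries_unique _ _ _ (is_exp_Reals (- x))).
    (* The parity series depend on [x ^ 2] only, so those found at [x] also serve at [- x]. *)
    replace (x ^ 2) with ((- x) ^ 2) in * by ring.
    change (fun n => / INR (fact n)) with a.
    rewrite (is_pseries_unique _ _ _ (is_pseries_odd_even _ _ _ _ HE HO)); ring. }
  apply is_pseries_R in HE; apply is_pseries_R in HO.
  split.
  - replace (sinh x) with (x * PSeries (fun k => a (2 * k + 1)%nat) (x ^ 2))
      by (unfold sinh; rewrite X1, X2; field).
    apply is_series_ext with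
      (fun k => scal x (a (2 * k + 1)%nat * (x ^ 2) ^ k)).
    + intro k; change (x * (a (2 * k + 1)%nat * (x ^ 2) ^ k)
                       = x ^ (2 * k + 1) / INR (fact (2 * k + 1))).
      rewrite pow_add, pow_mult; unfold a, Rdiv; ring.
    + apply (is_series_scal_l (V := R_NormedModule)); exact HO.
  - replace (cosh x) with (PSeries (fun k => a (2 * k)%nat) (x ^ 2))
      by (unfold cosh; rewrite X1, X2; field).
    apply is_series_ext with (fun k => a (2 * k)%nat * (x ^ 2) ^ k); [|exact HE].
    intro k; rewrite pow_mult; apply Rmult_comm.
Qed.

(** The difference cosh x - sinh x is exp(-x), at most 1 for nonnegative x. *)
Lemma cosh_sub_1_le_sinh (x : R) : 0 <= x -> cosh x - 1 <= sinh x.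
Proof.
  intro Hx; unfold cosh, sinh.
  assert (exp (- x) <= 1); [|lra].
  rewrite <- exp_0; destruct Hx as [Hx | <-]; [left; apply exp_increasing; lra | right; f_equal; ring].
Qed.

(** * The Bessel functions of orders 0 and 1 as power series in (x/2)^2 *)

Definition bessel_I0_coeff (k : nat) : R := / INR (fact k) ^ 2.

Lemma CV_radius_bessel_I0 : CV_radius bessel_I0_coeff = p_infty.
Proof.
  apply CV_radius_infinite_of_ratio; intro n; unfold bessel_I0_coeff.
  - apply Rinv_0_lt_compat, pow_lt, INR_fact_lt_0.
  - rewrite fact_simpl, mult_INR.
    assert (F := INR_fact_lt_0 n).
    assert (1 <= INR (S n)) by (rewrite S_INR; assert (P := pos_INR n); lra).
    apply (Rmult_le_reg_l (INR (S n) * INR (fact n) ^ 2));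
      [apply Rmult_lt_0_compat; [lra | apply pow_lt; exact F]|].
    apply Rle_trans with 1; [right; field; lra|].
    apply Rle_trans with (INR (S n)); [lra | right; field; lra].
Qed.

Lemma bessel_I0_PSeries (x : R) : bessel_I 0 x = PSeries bessel_I0_coeff ((x / 2) ^ 2).
Proof.
  apply Series_ext; intro k; unfold bessel_I0_coeff.
  rewrite !Nat.add_0_r, <- pow_mult; field; apply INR_fact_neq_0.
Qed.

(** The derived coefficient (k+1)/((k+1)!)^2 equals 1/(k! (k+1)!), the coefficient of order 1; the
    odd power leaves the factor x/2. *)
Lemma bessel_I1_PSeries (x : R) :
  bessel_I 1 x = x / 2 * PSeries (PS_derive bessel_I0_coeff) ((x / 2) ^ 2).
Proof.
  unfold PSeries; rewrite <- Series_scal_l.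
  apply Series_ext; intro k; unfold bessel_I0_coeff, PS_derive.
  rewrite Nat.add_1_r, <- tech_pow_Rmult, <- pow_mult, Nat.add_1_r, fact_simpl, mult_INR.
  field; split; [apply INR_fact_neq_0 | apply not_0_INR; lia].
Qed.

(** Chain rule: the derivative of (x/2)^2 is x/2, exactly the prefactor in [bessel_I1_PSeries]. *)
Lemma is_derive_bessel_I0 (x : R) : is_derive (bessel_I 0) x (bessel_I 1 x).
Proof.
  apply is_derive_ext with (fun x => PSeries bessel_I0_coeff ((x / 2) ^ 2)).
  { intro; symmetry; apply bessel_I0_PSeries. }
  rewrite bessel_I1_PSeries.
  apply (is_derive_comp (V := R_NormedModule) (PSeries bessel_I0_coeff) (fun x => (x / 2) ^ 2)).
  - apply is_derive_PSeries; rewrite CV_radius_bessel_I0; exact I.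
  - auto_derive; trivial; simpl; field.
Qed.

Lemma ex_derive_bessel_I1 (x : R) : ex_derive (bessel_I 1) x.
Proof.
  apply ex_derive_ext with
    (fun x => x / 2 * PSeries (PS_derive bessel_I0_coeff) ((x / 2) ^ 2)).
  { intro; symmetry; apply bessel_I1_PSeries. }
  auto_derive; repeat split.
  apply ex_derive_PSeries; rewrite CV_radius_derive, CV_radius_bessel_I0; exact I.
Qed.

(** The partial sums are nonnegative, hence so is their limit in [Rbar]; [Series] reads an infinite
    limit as 0, which keeps the sign. *)
Lemma Series_nonneg (u : nat -> R) : (forall n, 0 <= u n) -> 0 <= Series u.
Proof.
  intro Hu.
  assert (L : Rbar_le 0 (Lim_seq (sum_n u))).
  { rewrite <- (Lim_seq_const 0); apply Lim_seq_le_loc; exists 0%nat; intros n _.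
    induction n as [|n IH]; [rewrite sum_O; apply Hu|].
    rewrite sum_Sn; unfold plus; simpl; assert (P := Hu (S n)); lra. }
  unfold Series; destruct (Lim_seq (sum_n u)); simpl in *; lra.
Qed.

Lemma bessel_I_nonneg (v : nat) (x : R) : 0 <= x -> 0 <= bessel_I v x.
Proof.
  intro Hx; apply Series_nonneg; intro k.
  apply Rdiv_le_0_compat; [apply pow_le; lra|].
  apply Rmult_lt_0_compat; apply INR_fact_lt_0.
Qed.

(** * Comparison of the Bessel function of order 1 with sinh *)

Lemma bessel_I1_coeff_wallis (x : R) (k : nat) :
  (x / 2) ^ (2 * k + 1) / (INR (fact k) * INR (fact (k + 1)))
  = wallis (S k) * (x ^ (2 * k + 1) / INR (fact (2 * k + 1))).
Proof.
  (* Both sides equal x^(2k+1) / (2^(2k+1) k! (k+1)!), because (2k+2)! = 2 (k+1) (2k+1)!. *)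
  unfold wallis.
  replace (2 * S k)%nat with (S (2 * k + 1)) by lia.
  rewrite (Nat.add_1_r k), !fact_simpl, !mult_INR, !S_INR, plus_INR, mult_INR.
  change (INR 2) with 2; change (INR 1) with 1; change (2 ^ S k) with (2 * 2 ^ k).
  replace ((x / 2) ^ (2 * k + 1)) with (x ^ (2 * k + 1) / 2 ^ (2 * k + 1))
    by (unfold Rdiv; rewrite Rpow_mult_distr, pow_inv; reflexivity).
  replace (2 ^ (2 * k + 1)) with (2 ^ k * 2 ^ k * 2)
    by (rewrite pow_add, Nat.mul_comm, pow_mult; ring).
  assert (INR (fact k) <> 0) by apply INR_fact_neq_0.
  assert (INR (fact (2 * k + 1)) <> 0) by apply INR_fact_neq_0.
  assert (2 ^ k <> 0) by (apply pow_nonzero; lra).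
  assert (0 <= INR k) by apply pos_INR.
  field; repeat split; try assumption; lra.
Qed.

(* AM-GM on the Wallis ratio; [l = sqrt (PI * x / 2)] balances the two parts. *)
Lemma bessel_I1_term_le (x l : R) (k : nat) :
  0 < x -> 0 < l -> l ^ 2 = PI * x / 2 ->
  wallis (S k) * (x ^ (2 * k + 1) / INR (fact (2 * k + 1)))
  <= / (2 * l) * (x ^ (2 * k + 1) / INR (fact (2 * k + 1))
                  + x ^ (2 * S k) / INR (fact (2 * S k))).
Proof.
  intros Hx Hl E.
  assert (P := PI_RGT_0).
  assert (0 <= INR k) by apply pos_INR.
  set (p := x ^ (2 * k + 1) / INR (fact (2 * k + 1))).
  assert (Hp : 0 <= p).
  { left; apply Rdiv_lt_0_compat; [apply pow_lt, Hx | apply INR_fact_lt_0]. }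
  replace (x ^ (2 * S k) / INR (fact (2 * S k))) with (p * (x / (2 * (INR k + 1)))).
  2: { unfold p; replace (2 * S k)%nat with (S (2 * k + 1)) by lia.
       rewrite fact_simpl, mult_INR, S_INR, plus_INR, mult_INR, <- tech_pow_Rmult.
       change (INR 2) with 2; change (INR 1) with 1.
       field; split; [apply INR_fact_neq_0 | lra]. }
  assert (B := wallis_bound k).
  assert (W := wallis_pos (S k)).
  set (w := wallis (S k)) in *.
  assert (K : 2 * l * w <= 1 + x / (2 * (INR k + 1))).
  { assert (l ^ 2 * w ^ 2 <= x / (2 * (INR k + 1))).
    { apply (Rmult_le_reg_r (2 * (INR k + 1))); [lra|].
      apply Rle_trans with (x * (w ^ 2 * (PI * (INR k + 1)))); [rewrite E; right; field|].
      apply Rle_trans with (x * 1); [apply Rmult_le_compat_l; lra | right; field; lra]. }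
    assert (0 <= (l * w - 1) ^ 2) by apply pow2_ge_0.
    nra. }
  apply (Rmult_le_reg_l (2 * l)); [lra|].
  apply Rle_trans with (p * (2 * l * w)); [right; ring|].
  apply Rle_trans with (p * (1 + x / (2 * (INR k + 1)))).
  - apply Rmult_le_compat_l; assumption.
  - right; field; lra.
Qed.

(* The right-hand side is [sqrt x] times the Bessel function of order 1/2. *)
Lemma bessel_I1_le_sinh (x : R) :
  0 <= x -> sqrt x * bessel_I 1 x <= sqrt (2 / PI) * sinh x.
Proof.
  intros [Hx | <-]; [|rewrite sqrt_0, sinh_0; lra].
  assert (P := PI_RGT_0).
  set (l := sqrt (PI * x / 2)).
  assert (Hl0 : 0 < PI * x / 2) by nra.
  assert (Hl : 0 < l) by (apply sqrt_lt_R0, Hl0).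
  assert (E : l ^ 2 = PI * x / 2) by (apply pow2_sqrt; lra).
  destruct (is_series_sinh_cosh x) as [HS HC].
  (* Dropping the constant term of cosh pairs the sinh term of degree 2k+1 with the cosh term of
     degree 2k+2. *)
  assert (HC' : is_series (fun k => x ^ (2 * S k) / INR (fact (2 * S k))) (cosh x - 1)).
  { apply (is_series_incr_1 (V := R_NormedModule) (fun k => x ^ (2 * k) / INR (fact (2 * k)))).
    replace (plus (cosh x - 1) _) with (cosh x); [exact HC|].
    unfold plus; simpl; field. }
  assert (HU : is_series (fun k => / (2 * l) *
      (x ^ (2 * k + 1) / INR (fact (2 * k + 1)) + x ^ (2 * S k) / INR (fact (2 * S k))))
      (/ (2 * l) * (sinh x + (cosh x - 1)))).
  { apply (is_series_scal_l (V := R_NormedModule)).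
    apply (is_series_plus (V := R_NormedModule)); assumption. }
  assert (I : bessel_I 1 x <= sinh x / l).
  { apply Rle_trans with (/ (2 * l) * (sinh x + (cosh x - 1))).
    - rewrite <- (is_series_unique _ _ HU).
      apply Series_le; [|eexists; exact HU].
      intro k; split.
      + left; apply Rdiv_lt_0_compat; [apply pow_lt; lra|].
        apply Rmult_lt_0_compat; apply INR_fact_lt_0.
      + rewrite bessel_I1_coeff_wallis; apply bessel_I1_term_le; assumption.
    - assert (C := cosh_sub_1_le_sinh x (Rlt_le _ _ Hx)).
      apply (Rmult_le_reg_l (2 * l)); [lra|].
      apply Rle_trans with (sinh x + (cosh x - 1)); [right; field; lra|].
      apply Rle_trans with (2 * sinh x); [lra | right; field; lra]. }
  apply Rle_trans with (sqrt x * (sinh x / l)).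
  - apply Rmult_le_compat_l; [apply sqrt_pos | exact I].
  - right; replace (sqrt x) with (sqrt (2 / PI) * l); [field; lra|].
    unfold l; rewrite <- sqrt_mult_alt.
    + f_equal; field; lra.
    + left; apply Rdiv_lt_0_compat; lra.
Qed.

(** * Improper integrals handled through primitives *)

Lemma primitive_le (f g F G : R -> R) (x y : R) :
  x <= y ->
  (forall t, is_derive F t (f t)) -> (forall t, continuous f t) ->
  (forall t, is_derive G t (g t)) -> (forall t, continuous g t) ->
  (forall t, x <= t -> f t <= g t) ->
  F y - F x <= G y - G x.
Proof.
  intros Hxy HF Cf HG Cg Hle.
  apply (is_RInt_le f g x y); [exact Hxy | | | intros t Ht; apply Hle; lra].
  - apply (is_RInt_derive (V := R_CompleteNormedModule) F f); intros; auto.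
  - apply (is_RInt_derive (V := R_CompleteNormedModule) G g); intros; auto.
Qed.

(** The limit is the supremum of the values of [G] from [x] on. *)
Lemma is_lim_bounded_increasing (G : R -> R) (x M : R) :
  (forall s t, x <= s -> s <= t -> G s <= G t) ->
  (forall t, x <= t -> G t <= M) ->
  exists l : R, is_lim G p_infty l /\ l <= M.
Proof.
  intros Hinc HM.
  destruct (completeness (fun y => exists t, x <= t /\ y = G t)) as [l [Hub Hlub]].
  - exists M; intros y [t [Ht ->]]; apply HM, Ht.
  - exists (G x), x; split; [lra | reflexivity].
  - exists l; split.
    + apply is_lim_spec; intros [e He]; simpl.
      assert (N : ~ (forall t, x <= t -> G t <= l - e)).
      { intro N; assert (l <= l - e); [|lra].
        apply Hlub; intros y [t [Ht ->]]; apply N, Ht. }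
      apply not_all_ex_not in N as [s N].
      apply imply_to_and in N as [Hs N].
      exists s; intros t Ht.
      assert (G t <= l) by (apply Hub; exists t; split; [lra | reflexivity]).
      assert (G s <= G t) by (apply Hinc; lra).
      apply Rabs_def1; lra.
    + apply Hlub; intros y [t [Ht ->]]; apply HM, Ht.
Qed.

Lemma int_from_primitive (f G : R -> R) (x l : R) :
  (forall t, is_derive G t (f t)) -> (forall t, continuous f t) ->
  is_lim G p_infty l -> int_from f x = l - G x.
Proof.
  intros HG Cf HL.
  apply is_RInt_gen_unique; intros P HP.
  assert (HL' : is_lim (fun t => G t - G x) p_infty (l - G x))
    by (apply is_lim_minus'; [exact HL | apply is_lim_const]).
  apply Filter_prod with (fun a => a = x) (fun t => P (G t - G x)).
  - reflexivity.
  - exact (HL' P HP).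
  - intros a t -> Ht; exists (G t - G x); split; [|exact Ht].
    apply (is_RInt_derive (V := R_CompleteNormedModule) G f); intros; auto.
Qed.

Lemma is_derive_RInt_continuous (f : R -> R) (x : R) :
  (forall t, continuous f t) -> forall t, is_derive (RInt f x) t (f t).
Proof.
  intros Cf t; apply (is_derive_RInt (V := R_NormedModule) f (RInt f x) x t).
  - apply filter_forall; intro y.
    apply (RInt_correct (V := R_CompleteNormedModule)).
    apply (ex_RInt_continuous (V := R_CompleteNormedModule)); auto.
  - apply Cf.
Qed.

(** Nonnegativity makes the partial integrals increase, so the bound [M] also provides the
    convergence that gives [int_from] its meaning. *)
Lemma int_from_le (f : R -> R) (x M : R) :
  (forall t, continuous f t) -> (forall t, x <= t -> 0 <= f t) ->
  (forall t, x <= t -> RInt f x t <= M) -> int_from f x <= M.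
Proof.
  intros Cf Hpos HM.
  assert (D := is_derive_RInt_continuous f x Cf).
  destruct (is_lim_bounded_increasing (RInt f x) x M) as [l [HL Hl]]; [|exact HM|].
  - intros s t Hs Hst.
    assert (L := primitive_le (fun _ => 0) f (fun _ => 0) (RInt f x) s t Hst).
    cut (0 - 0 <= RInt f x t - RInt f x s); [lra|].
    apply L; auto.
    + intro; apply (is_derive_const (V := R_NormedModule)).
    + intro; apply continuous_const.
    + intros; apply Hpos; lra.
  - rewrite (int_from_primitive f (RInt f x) x l D Cf HL), RInt_point.
    unfold zero; simpl; lra.
Qed.

(** * The Gaussian integral *)

Definition gauss (t : R) : R := exp (- (t ^ 2 / 2)).

Lemma continuous_gauss (t : R) : continuous gauss t.
Proof. apply (ex_derive_continuous (V := R_NormedModule)); unfold gauss; auto_derive; trivial. Qed.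

Lemma is_derive_RInt_gauss (t : R) : is_derive (RInt gauss 0) t (gauss t).
Proof. apply is_derive_RInt_continuous, continuous_gauss. Qed.

Lemma RInt_gauss_increasing (s t : R) : s <= t -> RInt gauss 0 s <= RInt gauss 0 t.
Proof.
  intro Hst.
  cut (0 - 0 <= RInt gauss 0 t - RInt gauss 0 s); [lra|].
  apply (primitive_le (fun _ => 0) gauss (fun _ => 0) (RInt gauss 0) s t Hst).
  - intro; apply (is_derive_const (V := R_NormedModule)).
  - intro; apply continuous_const.
  - apply is_derive_RInt_gauss.
  - apply continuous_gauss.
  - intros; left; apply exp_pos.
Qed.

(** Here [C] is the integral over the positive half-line. Its value is left open because it cancels
    in a difference of two values of [gaussQ]. *)
Lemma int_from_gauss : exists C : R, forall x, int_from gauss x = C - RInt gauss 0 x.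
Proof.
  (* The bound is the integral of exp(1/2 - t) over the positive half-line, which dominates [gauss]
     since (t-1)^2 >= 0. *)
  destruct (is_lim_bounded_increasing (RInt gauss 0) 0 (exp (1 / 2))) as [C [HC _]].
  - intros; apply RInt_gauss_increasing; assumption.
  - intros t Ht.
    assert (L : RInt gauss 0 t - RInt gauss 0 0 <= - exp (1 / 2 - t) - - exp (1 / 2 - 0)).
    { apply (primitive_le gauss (fun t => exp (1 / 2 - t)) (RInt gauss 0)
               (fun t => - exp (1 / 2 - t)) 0 t Ht).
      - apply is_derive_RInt_gauss.
      - apply continuous_gauss.
      - intro; auto_derive; trivial; unfold Rminus; ring.
      - intro; apply (ex_derive_continuous (V := R_NormedModule)); auto_derive; trivial.
      - intros s _; unfold gauss.
        assert (H : - (s ^ 2 / 2) <= 1 / 2 - s)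
          by (assert (0 <= (s - 1) ^ 2) by apply pow2_ge_0; lra).
        destruct H as [H | ->]; [left; apply exp_increasing, H | right; reflexivity]. }
    rewrite RInt_point in L; change zero with 0 in L; rewrite !Rminus_0_r in L.
    assert (0 < exp (1 / 2 - t)) by apply exp_pos; lra.
  - exists C; intro x.
    apply int_from_primitive; [apply is_derive_RInt_gauss | apply continuous_gauss | exact HC].
Qed.

Lemma gauss_shift_sub (a t : R) :
  gauss (t - a) - gauss (t + a) = exp (- ((t ^ 2 + a ^ 2) / 2)) * (2 * sinh (a * t)).
Proof.
  unfold gauss, sinh.
  replace (- ((t - a) ^ 2 / 2)) with (- ((t ^ 2 + a ^ 2) / 2) + a * t) by field.
  replace (- ((t + a) ^ 2 / 2)) with (- ((t ^ 2 + a ^ 2) / 2) + - (a * t)) by field.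
  rewrite !exp_plus; field.
Qed.

(** * Bounding the Marcum Q-function by Gaussian Q-functions *)

Lemma bessel_I1_scaled_le (a t r : R) :
  0 <= a -> 0 <= t -> 0 <= r -> a <= r ^ 2 * t ->
  a * bessel_I 1 (a * t) <= r * (/ sqrt (2 * PI) * (2 * sinh (a * t))).
Proof.
  intros Ha Ht Hr H.
  assert (P := PI_RGT_0).
  assert (B := bessel_I1_le_sinh (a * t) (Rmult_le_pos _ _ Ha Ht)).
  (* This form exhibits the normalisation of [gaussQ] and the factor 2 of [gauss_shift_sub]. *)
  replace (sqrt (2 / PI)) with (/ sqrt (2 * PI) * 2) in B.
  2: { assert (0 < sqrt (2 * PI)) by (apply sqrt_lt_R0; lra).
       apply (Rmult_eq_reg_l (sqrt (2 * PI))); [|lra].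
       rewrite <- sqrt_mult_alt by lra.
       replace (2 * PI * (2 / PI)) with (2 * 2) by (field; lra).
       rewrite sqrt_square by lra; field; lra. }
  rewrite (Rmult_assoc _ 2) in B.
  assert (I : 0 <= bessel_I 1 (a * t)) by (apply bessel_I_nonneg, Rmult_le_pos; assumption).
  (* Since [sqrt a <= r * sqrt t], the factor [a] is at most [r * sqrt (a * t)]. *)
  apply Rle_trans with (r * (sqrt (a * t) * bessel_I 1 (a * t)));
    [|apply Rmult_le_compat_l; assumption].
  rewrite <- Rmult_assoc; apply Rmult_le_compat_r; [exact I|].
  rewrite sqrt_mult by assumption.
  assert (S : sqrt a <= r * sqrt t).
  { rewrite <- (sqrt_pow2 r) at 1 by exact Hr.
    rewrite <- sqrt_mult by (try apply pow2_ge_0; assumption).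
    apply sqrt_le_1_alt, H. }
  assert (Q := sqrt_pos a).
  rewrite <- (sqrt_def a) at 1 by exact Ha; nra.
Qed.

(** Integration by parts in differential form: the first term is the Marcum integrand, the second is
    the one that the sinh bound controls. *)
Lemma is_derive_bessel_I0_gauss (a t : R) :
  is_derive (fun t => - (exp (- ((t ^ 2 + a ^ 2) / 2)) * bessel_I 0 (a * t))) t
    (t * exp (- ((t ^ 2 + a ^ 2) / 2)) * bessel_I 0 (a * t)
     - exp (- ((t ^ 2 + a ^ 2) / 2)) * (a * bessel_I 1 (a * t))).
Proof.
  auto_derive.
  - repeat split; exists (bessel_I 1 (a * t)); apply is_derive_bessel_I0.
  - change (fun x : R => bessel_I 0 x) with (bessel_I 0).
    rewrite (is_derive_unique _ _ _ (is_derive_bessel_I0 (a * t))).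
    replace (t * (t * 1) + a * (a * 1)) with (t ^ 2 + a ^ 2) by ring.
    unfold Rdiv; field.
Qed.

(** The last hypothesis extends from [b] to all [t >= b], so one [r] serves the whole range of
    integration. For [b > 0] the smallest admissible [r] is sqrt(a/b). *)
Lemma marcumQ1_le (a b r : R) :
  0 <= a -> 0 <= b -> 0 <= r -> a <= r ^ 2 * b ->
  marcumQ1 a b <= exp (- ((b ^ 2 + a ^ 2) / 2)) * bessel_I 0 (a * b)
                  + r * (gaussQ (b - a) - gaussQ (b + a)).
Proof.
  intros Ha Hb Hr H.
  assert (P := PI_RGT_0).
  destruct int_from_gauss as [C HC].
  assert (H2 : 0 < sqrt (2 * PI)) by (apply sqrt_lt_R0; lra).
  unfold gaussQ; change (fun t : R => exp (- (t ^ 2 / 2))) with gauss; rewrite !HC.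
  set (c := r * / sqrt (2 * PI)).
  set (F := fun t => - (exp (- ((t ^ 2 + a ^ 2) / 2)) * bessel_I 0 (a * t))).
  set (m := fun t => t * exp (- ((t ^ 2 + a ^ 2) / 2)) * bessel_I 0 (a * t)).
  assert (DI : forall x, ex_derive (bessel_I 0) x)
    by (intro x; exists (bessel_I 1 x); apply is_derive_bessel_I0).
  assert (Cm : forall t, continuous m t).
  { intro t; apply (ex_derive_continuous (V := R_NormedModule)); unfold m; auto_derive.
    repeat split; apply DI. }
  apply Rle_trans with (- F b + c * (RInt gauss 0 (b + a) - RInt gauss 0 (b - a))).
  2: { unfold F, c; right; field; lra. }
  apply (int_from_le m); [exact Cm | | intros T HT].
  { intros t Ht; apply Rmult_le_pos; [|apply bessel_I_nonneg, Rmult_le_pos; lra].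
    apply Rmult_le_pos; [lra | left; apply exp_pos]. }
  (* On the right stands the increment of a primitive of [m], minus its order-1 remainder, plus the
     scaled sinh term that dominates this remainder. *)
  assert (L : RInt m b T - RInt m b b
              <= (F T + c * (RInt gauss 0 (T - a) - RInt gauss 0 (T + a)))
                 - (F b + c * (RInt gauss 0 (b - a) - RInt gauss 0 (b + a)))).
  { apply (primitive_le m
      (fun t => m t - exp (- ((t ^ 2 + a ^ 2) / 2)) * (a * bessel_I 1 (a * t))
                + c * (gauss (t - a) - gauss (t + a)))
      (RInt m b)
      (fun t => F t + c * (RInt gauss 0 (t - a) - RInt gauss 0 (t + a))) b T HT).
    - apply is_derive_RInt_continuous, Cm.
    - exact Cm.
    - intro t; apply (is_derive_plus (V := R_NormedModule)).
      + apply is_derive_bessel_I0_gauss.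
      + apply is_derive_scal, (is_derive_minus (V := R_NormedModule)).
        * rewrite <- (Rmult_1_l (gauss (t - a))).
          apply (is_derive_comp (V := R_NormedModule) (RInt gauss 0) (fun t => t - a));
            [apply is_derive_RInt_gauss | auto_derive; trivial].
        * rewrite <- (Rmult_1_l (gauss (t + a))).
          apply (is_derive_comp (V := R_NormedModule) (RInt gauss 0) (fun t => t + a));
            [apply is_derive_RInt_gauss | auto_derive; trivial].
    - intro t; apply (ex_derive_continuous (V := R_NormedModule)).
      unfold m, gauss; auto_derive; repeat split; try apply DI; apply ex_derive_bessel_I1.
    - intros t Ht.
      rewrite gauss_shift_sub; unfold c.
      assert (B := bessel_I1_scaled_le a t r Ha ltac:(lra) Hr ltac:(nra)).
      assert (X := exp_pos (- ((t ^ 2 + a ^ 2) / 2))).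
      apply (Rmult_le_compat_l _ _ _ (Rlt_le _ _ X)) in B; nra. }
  rewrite RInt_point in L; change zero with 0 in L.
  (* Both contributions at the upper end [T] are nonpositive; dropping them leaves a bound uniform
     in [T]. *)
  assert (FT : F T <= 0).
  { unfold F; assert (0 <= bessel_I 0 (a * T)) by (apply bessel_I_nonneg, Rmult_le_pos; lra).
    assert (X := exp_pos (- ((T ^ 2 + a ^ 2) / 2))); nra. }
  assert (G : RInt gauss 0 (T - a) <= RInt gauss 0 (T + a))
    by (apply RInt_gauss_increasing; lra).
  assert (0 <= c) by (apply Rmult_le_pos; [exact Hr | left; apply Rinv_0_lt_compat, H2]).
  nra.
Qed.

(** * The DQPSK error bound *)

Theorem proposition3 :
  let a := sqrt (2 * (1 - sqrt (1 / 2))) in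
  let b := sqrt (2 * (1 + sqrt (1 / 2))) in
  let delta := sqrt (b / a) in
  let H2 := fun gamma : R =>
    marcumQ1 (a * sqrt gamma) (b * sqrt gamma)
    - 1 / 2 * bessel_I 0 (sqrt 2 * gamma) * exp (- (2 * gamma)) in
  let U := fun gamma : R =>
    1 / delta * kernK a b gamma
    + 1 / 2 * bessel_I 0 (sqrt 2 * gamma) * exp (- (2 * gamma)) in
  forall gamma : R, 0 <= gamma -> H2 gamma <= U gamma.
Proof.
  intros a b delta H2 U gamma Hg; unfold H2, U, kernK.
  assert (S2 : 0 <= sqrt (1 / 2) < 1).
  { split; [apply sqrt_pos|]; apply Rlt_le_trans with (sqrt 1);
      [apply sqrt_lt_1_alt; lra | rewrite sqrt_1; lra]. }
  assert (Ha : 0 < a) by (apply sqrt_lt_R0; lra).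
  assert (Hb : 0 < b) by (apply sqrt_lt_R0; lra).
  assert (Ea : a ^ 2 = 2 * (1 - sqrt (1 / 2))) by (apply pow2_sqrt; lra).
  assert (Eb : b ^ 2 = 2 * (1 + sqrt (1 / 2))) by (apply pow2_sqrt; lra).
  assert (Eab : a * b = sqrt 2).
  { unfold a, b; rewrite <- sqrt_mult_alt by lra; f_equal.
    replace (2 * (1 - sqrt (1 / 2)) * (2 * (1 + sqrt (1 / 2))))
      with (4 - 4 * (sqrt (1 / 2) * sqrt (1 / 2))) by ring.
    rewrite sqrt_sqrt; lra. }
  assert (Hd : 0 < delta) by (apply sqrt_lt_R0, Rdiv_lt_0_compat; assumption).
  assert (Ed : delta ^ 2 = b / a) by (apply pow2_sqrt; left; apply Rdiv_lt_0_compat; assumption).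
  assert (Hs := sqrt_pos gamma).
  (* This bound contains the full term exp(-2 gamma) I_0(sqrt(2) gamma); subtracting the half in
     [H2] leaves the half in [U]. *)
  assert (M := marcumQ1_le (a * sqrt gamma) (b * sqrt gamma) (1 / delta)).
  replace ((b * sqrt gamma) ^ 2 + (a * sqrt gamma) ^ 2) with (4 * gamma) in M.
  2: { rewrite !Rpow_mult_distr, Ea, Eb, pow2_sqrt by exact Hg; ring. }
  replace (a * sqrt gamma * (b * sqrt gamma)) with (sqrt 2 * gamma) in M.
  2: { rewrite <- Eab, <- (sqrt_sqrt gamma) at 1 by exact Hg; ring. }
  replace (- (4 * gamma / 2)) with (- (2 * gamma)) in M by field.
  rewrite <- Rmult_minus_distr_r, <- Rmult_plus_distr_r in M.
  (* With [r = 1 / delta] the condition of [marcumQ1_le] holds with equality. *)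
  enough (R : a * sqrt gamma = (1 / delta) ^ 2 * (b * sqrt gamma)).
  { specialize (M ltac:(nra) ltac:(nra)
                  (Rlt_le _ _ (Rdiv_lt_0_compat _ _ Rlt_0_1 Hd)) (Req_le _ _ R)).
    lra. }
  replace ((1 / delta) ^ 2) with (/ delta ^ 2) by (field; lra).
  rewrite Ed; field; split; lra.
Qed.
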